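(* Let $k$ be a positive integer and let $\mu$ be a probability measure on $\Omega$ satisfying (Ak1), (Ak2) and (A4). Then $\mu$-almost surely there is at most one infinite primal contour.
   Context: Let $G$ be the square grid with vertex set $\mathbb{Z}^2$ and nearest-neighbour edges. The face of $G$ with lower-left corner $(m,n)$ is black if $m+n$ is even, white otherwise. $\Omega\subset\{0,1\}^{\mathbb{Z}^2}$ is the set of $\omega$ such that for every black face the states of its four vertices, listed clockwise from the lower-left corner, form one of $0000,1111,0011,1100,0110,1001$. Let $\mathbb{L}_1$ be the graph with vertices $(m-\tfrac12,n+\tfrac12)$, $m,n$ both even, and $\mathbb{L}_2$ the graph with vertices $(m-\tfrac12,n+\tfrac12)$, $m,n$ both odd; in each, two vertices are joined by an edge iff at Euclidean distance $2$. The center of each black face $F$ is the midpoint of exactly one edge $e_1$ of $\mathbb{L}_1$ and one edge $e_2$ of $\mathbb{L}_2$ (perpendicular). For $\omega\in\Omega$ define $\phi(\omega)\in\{0,1\}^{E(\mathbb{L}_1)\cup E(\mathbb{L}_2)}$: if the configuration around $F$ is $0000$ or $1111$ both $e_1,e_2$ get $0$; if the two upper vertices share a state different from the two lower ones, the horizontal one of $e_1,e_2$ gets $1$, the vertical $0$; if the two left vertices share a state different from the two right ones, the vertical one gets $1$, the horizontal $0$. Edges with value $1$ are present; a contour is a connected component of the set of present edges; a primal contour is one consisting of edges of $\mathbb{L}_1$; it is infinite if it has infinitely many edges. Assumptions on $\mu$: (Ak1) $\mu$ is invariant under translations by $2k\mathbb{Z}\times2k\mathbb{Z}$; (Ak2)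 every $2k\mathbb{Z}\times2k\mathbb{Z}$-translation-invariant event has $\mu$-probability $0$ or $1$; (A4) if $\nu_1$ is the law of the restriction of $\phi(\omega)$ to $E(\mathbb{L}_1)$, then for every face $S$ of $\mathbb{L}_1$ and every event $E$ with $\nu_1(E)>0$ we have $\nu_1(E_S)>0$, where $E_S=\{\psi_S:\psi\in E\}$ and $\psi_S$ is obtained from $\psi$ by flipping the states of the four sides of $S$. *)

(* Defs.v *)
From HB Require Import structures.
From mathcomp Require Import all_boot all_order all_algebra.
From mathcomp Require Import all_classical all_reals all_analysis.
Set Implicit Arguments. Unset Strict Implicit. Unset Printing Implicit Defensive.
Import Order.TTheory GRing.Theory Num.Theory.
Local Open Scope classical_set_scope.
Local Open Scope ring_scope.

Definition site := (int * int)%type.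
Definition config := site -> bool.

Definition cylinders (I : Type) : set (set (I -> bool)) :=
  [set A | exists (i : I) (b : bool), A = [set f | f i = b]].

Definition Config := g_sigma_algebraType (@cylinders site).

(* Face with lower-left corner (m,n) is black iff m+n is even. *)
Definition black (m n : int) : bool := (2 %| m + n)%Z.

Definition LL (m n : int) : site := (m, n).
Definition UL (m n : int) : site := (m, n + 1).
Definition UR (m n : int) : site := (m + 1, n + 1).
Definition LR (m n : int) : site := (m + 1, n).

(* allowed patterns, listed clockwise from the lower-left corner:
   0000,1111,0011,1100,0110,1001 *)
Definition allowed (a b c d : bool) : bool :=
  [|| [&& ~~ a, ~~ b, ~~ c & ~~ d], [&& a, b, c & d],
      [&& ~~ a, ~~ b, c & d], [&& a, b, ~~ c & ~~ d],
      [&& ~~ a, b, c & ~~ d] | [&& a, ~~ b, ~~ c & d]].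

Definition Omega : set Config :=
  [set w | forall m n : int, black m n ->
     allowed (w (LL m n)) (w (UL m n)) (w (UR m n)) (w (LR m n))].

(* "the two upper vertices share a state different from the two lower ones"
   -> the horizontal edge through the face centre gets 1 *)
Definition hval (w : config) (m n : int) : bool :=
  [&& w (UL m n) == w (UR m n), w (LL m n) == w (LR m n) &
      w (UL m n) != w (LL m n)].
(* "the two left vertices share a state different from the two right ones"
   -> the vertical edge through the face centre gets 1 *)
Definition vval (w : config) (m n : int) : bool :=
  [&& w (LL m n) == w (UL m n), w (LR m n) == w (UR m n) &
      w (LL m n) != w (LR m n)].

(* The lattice L1.  Its vertex (m - 1/2, n + 1/2) with m = 2i, n = 2j   *)
(* (m, n even) is indexed by (i, j) : Z^2.  Two vertices are at         *)
(* distance 2 iff their indices are nearest neighbours in Z^2, so an    *)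
(* edge of L1 is given by its left/lower endpoint (i,j) and a direction:*)
(*   (i,j,Hor) = {(i,j),(i+1,j)}   (horizontal edge)                    *)
(*   (i,j,Ver) = {(i,j),(i,j+1)}   (vertical edge)                      *)
Inductive dir := Hor | Ver.
Definition dir_eqb (a b : dir) : bool :=
  match a, b with Hor, Hor | Ver, Ver => true | _, _ => false end.
Lemma dir_eqP : Equality.axiom dir_eqb.
Proof. by case; case; constructor. Qed.
HB.instance Definition _ := hasDecEq.Build dir dir_eqP.

Definition L1vert := (int * int)%type.
Definition L1edge := (int * int * dir)%type.

Definition endpoints (e : L1edge) : L1vert * L1vert :=
  let: (i, j, d) := e in
  match d with
  | Hor => ((i, j), (i + 1, j))
  | Ver => ((i, j), (i, j + 1))
  end.

Definition incident (v : L1vert) (e : L1edge) : Prop :=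
  v = (endpoints e).1 \/ v = (endpoints e).2.

Definition share_vertex (e f : L1edge) : Prop :=
  exists v, incident v e /\ incident v f.

(* The black face whose centre is the midpoint of an L1 edge:
   horizontal edge (i,j,Hor): midpoint (2i+1/2, 2j+1/2) -> face (2i, 2j);
   vertical edge (i,j,Ver): midpoint (2i-1/2, 2j+3/2) -> face (2i-1, 2j+1). *)
Definition face_of (e : L1edge) : int * int :=
  let: (i, j, d) := e in
  match d with
  | Hor => (2 * i, 2 * j)
  | Ver => (2 * i - 1, 2 * j + 1)
  end.

Definition phi1 (w : config) : L1edge -> bool := fun e =>
  let: (m, n) := face_of e in
  match e.2 with
  | Hor => hval w m n
  | Ver => vval w m n
  end.

Definition EdgeConfig := g_sigma_algebraType (@cylinders L1edge).

(* Faces of L1: the face S = square with lower-left L1 vertex (i,j);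
   its four sides. *)
Definition side_of (s : L1vert) (e : L1edge) : bool :=
  let: (i, j) := s in
  [|| e == (i, j, Hor), e == (i, j + 1, Hor), e == (i, j, Ver)
    | e == (i + 1, j, Ver)].

Definition flip (s : L1vert) (psi : EdgeConfig) : EdgeConfig :=
  fun e => if side_of s e then ~~ psi e else psi e.

Inductive conn (psi : L1edge -> bool) : L1edge -> L1edge -> Prop :=
| conn_refl e : psi e -> conn psi e e
| conn_step e f g : conn psi e f -> psi g -> share_vertex f g -> conn psi e g.

Definition contour (psi : L1edge -> bool) (e : L1edge) : set L1edge :=
  [set f | conn psi e f].

Definition infinite_contour (psi : L1edge -> bool) (e : L1edge) : Prop :=
  psi e /\ ~ finite_set (contour psi e).

Definition at_most_one_infinite_primal (psi : L1edge -> bool) : Prop :=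
  forall e f, infinite_contour psi e -> infinite_contour psi f ->
    contour psi e = contour psi f.

Definition translate (a b : int) (w : Config) : Config :=
  fun x => w (x.1 + a, x.2 + b).

(* Main.v *)
(* A Burton-Keane argument.  On [Omega] the primal edge configuration has even
   degree at every vertex, hence inside a box it is the boundary of a spin
   configuration on the faces.  Flipping finitely many faces turns these spins into
   a checkerboard, which joins inside the box all the clusters that meet it; by (A4)
   finite sequences of flips preserve null events.  By (Ak2) the number of infinite
   clusters is almost surely at most one, exactly two, or at least three.  Two
   clusters could be merged with positive probability.  Three clusters could be
   merged inside some box with positive probability, so that by (Ak1) disjoint
   boxes of this kind have positive density; but each of them tripartitions the
   boundary of a large square, compatibly with the others, so their number is at
   most the length of that boundary. *)

Require Import Defs.
From HB Require Import structures.
From mathcomp Require Import all_boot all_order all_algebra.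
From mathcomp Require Import all_classical all_reals all_analysis.
From mathcomp Require Import zify.
Import Order.TTheory GRing.Theory Num.Theory.
Local Open Scope classical_set_scope.
Local Open Scope ring_scope.

Set Implicit Arguments.
Unset Strict Implicit.
Unset Printing Implicit Defensive.

(** * Connectivity *)

Definition joins (e : L1edge) (u v : L1vert) : Prop :=
  endpoints e = (u, v) \/ endpoints e = (v, u).

(** Clusters are followed through vertices, so that paths can be cut at a box. The relation also
    holds at isolated vertices, which [touched] excludes. *)
Inductive vconn (psi : L1edge -> bool) (u : L1vert) : L1vert -> Prop :=
| vconn_refl : vconn psi u u
| vconn_step v w e : vconn psi u v -> psi e -> joins e v w -> vconn psi u w.

Definition touched (psi : L1edge -> bool) (u : L1vert) : Prop :=
  exists2 e, psi e & incident u e.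

Definition box (c : L1vert) (n : nat) (v : L1vert) : bool :=
  (absz (v.1 - c.1)%R <= n)%N && (absz (v.2 - c.2)%R <= n)%N.

Definition inside (c : L1vert) (n : nat) (e : L1edge) : bool :=
  box c n (endpoints e).1 && box c n (endpoints e).2.

(** An edge with a single endpoint in the box counts as outer. *)
Definition outer (c : L1vert) (n : nat) (psi : L1edge -> bool) : L1edge -> bool :=
  fun e => psi e && ~~ inside c n e.

Definition inner (c : L1vert) (n : nat) (psi : L1edge -> bool) : L1edge -> bool :=
  fun e => psi e && inside c n e.

(** Boxes being finite, unboundedness stands for infinity; this form uses only countable
    quantifiers, which makes it measurable. *)
Definition in_infinite (psi : L1edge -> bool) (u : L1vert) : Prop :=
  forall m : nat, exists2 v, vconn psi u v & ~~ box (0, 0) m v.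

Lemma joins_sym e u v : joins e u v -> joins e v u.
Proof. by case; [right|left]. Qed.

Lemma joins_incidentl e u v : joins e u v -> incident u e.
Proof. by rewrite /incident; case=> ->; [left|right]. Qed.

Lemma joins_incidentr e u v : joins e u v -> incident v e.
Proof. by move/joins_sym/joins_incidentl. Qed.

Lemma inside_joins c n e u v : joins e u v -> inside c n e = box c n u && box c n v.
Proof. by rewrite /inside; case=> -> //=; rewrite andbC. Qed.

Lemma vconn_trans psi u v w : vconn psi u v -> vconn psi v w -> vconn psi u w.
Proof. by move=> uv; elim=> // x y e _ ux pe; apply: vconn_step pe. Qed.

Lemma vconn_sym psi u v : vconn psi u v -> vconn psi v u.
Proof.
elim=> [|x y e _ xu pe xy]; first exact: vconn_refl.
by apply: vconn_trans xu; apply: vconn_step (vconn_refl _ _) pe (joins_sym xy).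
Qed.

Lemma vconn_edge (psi : L1edge -> bool) e u v : psi e -> joins e u v -> vconn psi u v.
Proof. exact/vconn_step/vconn_refl. Qed.

Lemma vconn_mono (psi psi' : L1edge -> bool) u v :
  (forall e, psi e -> psi' e) -> vconn psi u v -> vconn psi' u v.
Proof.
move=> sub; elim=> [|x y e _ ux /sub pe]; first exact: vconn_refl.
exact: vconn_step pe.
Qed.

Lemma vconn_outer c n psi u v : vconn (outer c n psi) u v -> vconn psi u v.
Proof. by apply: vconn_mono => e /andP[]. Qed.

Lemma vconn_inner c n psi u v : vconn (inner c n psi) u v -> vconn psi u v.
Proof. by apply: vconn_mono => e /andP[]. Qed.

Lemma vconn_conn (psi : L1edge -> bool) e f u v :
  psi e -> psi f -> incident u e -> incident v f -> vconn psi u v -> conn psi e f.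
Proof.
move=> pe pf ue vf uv.
have [g eg vg] : exists2 g, conn psi e g & incident v g.
  elim: uv {pf vf} => [|x y h ux [g eg xg] ph xy]; first by exists e => //; exact: conn_refl.
  exists h; last exact: joins_incidentr xy.
  apply: conn_step eg ph _; exists x; split => //; exact: joins_incidentl xy.
by apply: conn_step eg pf _; exists v.
Qed.

Lemma incident_vconn (psi : L1edge -> bool) e u v :
  psi e -> incident u e -> incident v e -> vconn psi u v.
Proof.
move=> pe ue ve; have j : joins e (endpoints e).1 (endpoints e).2.
  by left; case: (endpoints e).
case: ue => ->; case: ve => ->; try exact: vconn_refl; apply: vconn_edge pe _ => //.
exact: joins_sym.
Qed.

Lemma conn_vconn (psi : L1edge -> bool) e f : conn psi e f ->
  [/\ psi e, psi f & forall u v, incident u e -> incident v f -> vconn psi u v].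
Proof.
elim=> [g pg|{}e g h _ [pe pg eg] ph [x [xg xh]]]; split=> // u v ue vf.
  exact: incident_vconn ue vf.
by apply: vconn_trans (eg _ _ ue xg) _; exact: incident_vconn xh vf.
Qed.

Lemma finite_edges_box m : finite_set [set e : L1edge | inside (0, 0) m e].
Proof.
pose f (t : 'I_(m + m).+1 * 'I_(m + m).+1 * bool) : L1edge :=
  ((t.1.1 : nat)%:Z - m%:Z, (t.1.2 : nat)%:Z - m%:Z, if t.2 then Hor else Ver).
apply: (@sub_finite_set _ _ (f @` setT)); last exact/finite_image/finite_finset.
move=> [[i j] d]; rewrite /inside /box /= => h.
have hi : (absz (i + m%:Z)%R < (m + m).+1)%N by case: d h => /=; lia.
have hj : (absz (j + m%:Z)%R < (m + m).+1)%N by case: d h => /=; lia.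
exists (Ordinal hi, Ordinal hj, if d is Hor then true else false) => //.
rewrite /f /=; have -> : (absz (i + m%:Z))%:Z - m%:Z = i by case: d h => /=; lia.
have -> : (absz (j + m%:Z))%:Z - m%:Z = j by case: d h => /=; lia.
by case: d {h}.
Qed.

Lemma infinite_contour_in_infinite (psi : L1edge -> bool) e u :
  infinite_contour psi e -> incident u e -> in_infinite psi u.
Proof.
move=> [pe infc] ue m; apply: contrapT => noexit; apply: infc.
apply: sub_finite_set (finite_edges_box m) => f /= /conn_vconn[_ pf ef].
by apply/andP; split; apply: contrapT => /negP ho; apply: noexit;
  eexists; try exact: ho; apply: ef => //; [left|right].
Qed.

Lemma one_infinite_cluster_contour (psi : L1edge -> bool) :
  (forall u v, in_infinite psi u -> in_infinite psi v -> vconn psi u v) ->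
  at_most_one_infinite_primal psi.
Proof.
move=> h e f ie jf.
have ue : incident (endpoints e).1 e by left.
have uf : incident (endpoints f).1 f by left.
have pe := ie.1; have pf := jf.1.
have ef := h _ _ (infinite_contour_in_infinite ie ue) (infinite_contour_in_infinite jf uf).
apply/seteqP; split=> g /= /conn_vconn[_ pg eg];
  apply: (vconn_conn (v := (endpoints g).1)) => //; try (by left); try eassumption.
- by apply: vconn_trans (vconn_sym ef) _; apply: eg => //; left.
- by apply: vconn_trans ef _; apply: eg => //; left.
Qed.

(** * Counting encounter boxes *)

(** [P] is meant as a partial equivalence relation, with domain the [y] such that [P y y]. *)
Definition three_classes (T : eqType) (P : T -> T -> Prop) (Y : seq T) : Prop :=
  exists y1 y2 y3, [/\ [/\ y1 \in Y, y2 \in Y & y3 \in Y],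
    [/\ P y1 y1, P y2 y2 & P y3 y3] & [/\ ~ P y1 y2, ~ P y1 y3 & ~ P y2 y3]].

(** One class of [P] and one class of [Q] together cover both domains, as when two disjoint pieces
    are cut out of a connected graph. *)
Definition compatible (T : eqType) (P Q : T -> T -> Prop) (Y : seq T) : Prop :=
  exists D D' : T -> Prop,
    [/\ forall z, z \in Y -> P z z \/ Q z z -> D z \/ D' z,
        forall z z', D z -> D z' -> P z z' & forall z z', D' z -> D' z' -> Q z z'].

(** A [z] in [Y] related to [y] could replace it as a representative; so [y] is alone in its class,
    and two other classes meet [Y]. *)
Lemma three_classes_cons (T : eqType) (P : T -> T -> Prop) (y : T) (Y : seq T) :
  (forall a b, P a b -> P b a) -> (forall a b c, P a b -> P b c -> P a c) ->
  three_classes P (y :: Y) -> ~ three_classes P Y ->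
  [/\ P y y, forall z, z \in Y -> ~ P z y &
      exists2 z, z \in Y & exists2 z', z' \in Y & [/\ P z z, P z' z' & ~ P z z']].
Proof.
move=> Psym Ptr [y1 [y2 [y3 [[y1Y y2Y y3Y] [p1 p2 p3] [n12 n13 n23]]]]] nY.
have key a b : a \in Y -> b \in Y -> P y y -> P a a -> P b b ->
    ~ P y a -> ~ P y b -> ~ P a b ->
    [/\ P y y, forall z, z \in Y -> ~ P z y &
      exists2 z, z \in Y & exists2 z', z' \in Y & [/\ P z z, P z' z' & ~ P z z']].
  move=> aY bY py pa pb ya yb ab; split=> //.
  - move=> z zY pzy; apply: nY; exists z, a, b; split; split=> //.
    + exact: (Ptr _ _ _ pzy (Psym _ _ pzy)).
    + by move=> pza; apply: ya; exact: (Ptr _ _ _ (Psym _ _ pzy) pza).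
    + by move=> pzb; apply: yb; exact: (Ptr _ _ _ (Psym _ _ pzy) pzb).
  - by exists a => //; exists b.
have sn a b : ~ P a b -> ~ P b a by move=> nab /Psym.
move: y1Y y2Y y3Y; rewrite !inE.
case: eqP => [e1 _|_ /= y1Y]; case: eqP => [e2 _|_ /= y2Y];
  case: eqP => [e3 _|_ /= y3Y]; subst => //.
- by apply: (key y2 y3).
- by apply: (key y1 y3) => //; exact: sn.
- by apply: (key y1 y2) => //; exact: sn.
- by case: nY; exists y1, y2, y3.
Qed.

(* Deleting a point [y] of [Y] destroys at most one of the tripartitions: those
   that it destroys have [{y}] as a class, and two of them cannot be compatible. *)
Lemma compatible_tripartitions_bound (I T : eqType) (P : I -> T -> T -> Prop)
    (Y : seq T) (s : seq I) :
  (forall i a b, P i a b -> P i b a) ->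
  (forall i a b c, P i a b -> P i b c -> P i a c) ->
  uniq s -> (forall i, i \in s -> three_classes (P i) Y) ->
  (forall i j y, i \in s -> j \in s -> i != j -> P i y y -> P j y y ->
    compatible (P i) (P j) Y) ->
  (size s <= size Y)%N.
Proof.
move=> Psym Ptr; elim: Y s => [|y Y IH] s us tri comp.
  case: s us tri comp => //= i s _ tri _.
  by have [? [? [? [[]]]]] := tri i (mem_head _ _).
have comp' i j z : i \in s -> j \in s -> i != j -> P i z z -> P j z z ->
    compatible (P i) (P j) Y.
  move=> iS jS ij Pi Pj; have [D [D' [cov d d']]] := comp i j z iS jS ij Pi Pj.
  by exists D, D'; split=> // w wY; apply: cov; rewrite inE wY orbT.
have [all|] := pselect (forall i, i \in s -> three_classes (P i) Y).
  by apply: leqW; apply: IH us all comp'.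
move=> /existsNP[i /not_implyP[iS ni]].
have [yi si [a aY [a' a'Y [pa pa' naa']]]] :=
  three_classes_cons (Psym i) (@Ptr i) (tri i iS) ni.
rewrite (perm_size (perm_to_rem iS)) /= ltnS; apply: IH.
- exact: rem_uniq.
- move=> j; rewrite mem_rem_uniq // !inE => /andP[ji jS]; apply: contrapT => nj.
  have [yj sj [b bY [b' b'Y [pb pb' nbb']]]] :=
    three_classes_cons (Psym j) (@Ptr j) (tri j jS) nj.
  have [D [D' [cov d d']]] := comp i j y iS jS (contra_neq (@esym _ _ _) ji) yi yj.
  have YY z : z \in Y -> z \in y :: Y by rewrite inE => ->; rewrite orbT.
  (* If [y] is in [D], then [b] and [b'] are not, as [y] is alone in its class for [P i]; both are
     in [D'], hence related by [P j]. The other case exchanges [i] and [j]. *)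
  have [Dy|D'y] := cov y (mem_head _ _) (or_introl yi).
  + have [/d /(_ Dy)|D'b] := cov b (YY _ bY) (or_intror pb); first exact: si.
    have [/d /(_ Dy)|D'b'] := cov b' (YY _ b'Y) (or_intror pb'); first exact: si.
    exact: nbb' (d' _ _ D'b D'b').
  + have [Da|/d' /(_ D'y)] := cov a (YY _ aY) (or_introl pa); last exact: sj.
    have [Da'|/d' /(_ D'y)] := cov a' (YY _ a'Y) (or_introl pa'); last exact: sj.
    exact: naa' (d _ _ Da Da').
- by move=> j k z /mem_rem jS /mem_rem kS; apply: comp'.
Qed.

(** The box plays the part of an encounter point: it hangs together inside, and deleting its inner
    edges leaves at least three infinite branches. *)
Definition encounter (c : L1vert) (n : nat) (psi : L1edge -> bool) : Prop :=
  (forall u v, box c n u -> box c n v -> touched (outer c n psi) u ->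
     touched (outer c n psi) v -> vconn (inner c n psi) u v) /\
  (exists u1 u2 u3, [/\ [/\ box c n u1, box c n u2 & box c n u3],
     [/\ in_infinite (outer c n psi) u1, in_infinite (outer c n psi) u2 &
       in_infinite (outer c n psi) u3] &
     [/\ ~ vconn (outer c n psi) u1 u2, ~ vconn (outer c n psi) u1 u3 &
         ~ vconn (outer c n psi) u2 u3]]).

Definition sphere (R : nat) : seq L1vert :=
  let r := [seq (i%:Z - R%:Z)%R | i <- iota 0 (R + R).+1] in
  [seq (x, R%:Z) | x <- r] ++ [seq (x, - R%:Z) | x <- r] ++
  [seq (R%:Z, x) | x <- r] ++ [seq (- R%:Z, x) | x <- r].

Lemma size_sphere R : size (sphere R) = (4 * (R + R).+1)%N.
Proof. by rewrite /sphere !size_cat !size_map !size_iota; lia. Qed.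

Lemma mem_sphere R v : box (0, 0) R v ->
  (forall m, (m < R)%N -> ~~ box (0, 0) m v) -> v \in sphere R.
Proof.
case: v => x y; rewrite /box /= => /andP[hx hy] hm.
have rP z : (absz (z - 0)%R <= R)%N -> z \in [seq (i%:Z - R%:Z)%R | i <- iota 0 (R + R).+1].
  move=> hz; apply/mapP; exists (absz (z + R%:Z)%R); first by rewrite mem_iota; lia.
  by lia.
have /orP ex : (absz x == R) || (absz y == R).
  by case: R hx hy hm {rP} => [|R] hx hy hm; [lia|have := hm R; lia].
rewrite /sphere !mem_cat.
have [->|[->|[->|->]]] : y = R%:Z \/ y = - R%:Z \/ x = R%:Z \/ x = - R%:Z by lia.
- by rewrite map_f ?rP.
- by rewrite (map_f (fun x => (x, - R%:Z))) ?rP // orbT.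
- by rewrite (map_f (fun x => (R%:Z, x))) ?rP // !orbT.
- by rewrite (map_f (fun x => (- R%:Z, x))) ?rP // !orbT.
Qed.

Lemma sphere_outside R m v : v \in sphere R -> (m < R)%N -> ~~ box (0, 0) m v.
Proof.
by rewrite /sphere /box !mem_cat => /or4P[] /mapP[z _ ->] /=; lia.
Qed.

Lemma joins_box e u v m : joins e u v -> box (0, 0) m u -> box (0, 0) m.+1 v.
Proof.
by case: e => [[i j] []]; case: u v => [a b] [a' b']; rewrite /box => -[] /= [*] /=; lia.
Qed.

(** An edge changes the sup norm by at most one, so a path leaving the box of radius [R.-1] first
    lands on the sphere. *)
Lemma in_infinite_sphere psi u R : (0 < R)%N -> box (0, 0) R.-1 u -> in_infinite psi u ->
  exists2 y, y \in sphere R & vconn psi u y.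
Proof.
move=> R0 bu iu; have [v uv] := iu R.
suff [bv|//] : box (0, 0) R.-1 v \/ exists2 y, y \in sphere R & vconn psi u y.
  by case/negP; move: bv; rewrite /box /=; lia.
elim: uv => [|x y e ux [bx|ex] pe xy]; [by left| |by right].
have by' : box (0, 0) R y by rewrite -(prednK R0); exact: joins_box xy bx.
have [b|b] := boolP (box (0, 0) R.-1 y); [by left|right; exists y].
  apply: mem_sphere => // m mR; apply: contra b.
  by rewrite /box /=; lia.
exact: vconn_step ux pe xy.
Qed.

Lemma vconn_touched psi u v : vconn psi u v ->
  u = v \/ (touched psi u /\ touched psi v).
Proof.
elim=> [|x y e _ [<-|[tu _]] pe xy]; first by left.
  by right; split; exists e => //; [exact: joins_incidentl xy|exact: joins_incidentr xy].
by right; split=> //; exists e => //; exact: joins_incidentr xy.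
Qed.

Lemma in_infinite_touched psi u : in_infinite psi u -> touched psi u.
Proof.
move=> /(_ (absz u.1 + absz u.2)%N)[v /vconn_touched[<-|[]//]].
by rewrite /box /=; lia.
Qed.

(* Follow a path of [psi] from [y] up to the first edge inside one of the two
   boxes: this edge is entered through a touched vertex of that box. *)
Lemma vconn_two_boxes c d n psi y t t' v :
  (forall e, inside c n e -> ~~ inside d n e) ->
  (forall u v, box c n u -> box c n v -> touched (outer c n psi) u ->
     touched (outer c n psi) v -> vconn (inner c n psi) u v) ->
  (forall u v, box d n u -> box d n v -> touched (outer d n psi) u ->
     touched (outer d n psi) v -> vconn (inner d n psi) u v) ->
  box c n t -> touched (outer c n psi) t -> box d n t' -> touched (outer d n psi) t' ->
  ~~ box c n y -> ~~ box d n y -> vconn psi y v ->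
  [\/ vconn (outer c n psi) y v /\ vconn (outer d n psi) y v,
      vconn (outer d n psi) y t | vconn (outer c n psi) y t'].
Proof.
move=> disj cc cd bt tt bt' tt' nyc nyd; elim=> [|x z e yx IH pe xz].
  by constructor 1; split; exact: vconn_refl.
case: IH => [[yxc yxd]|h|h]; [|by constructor 2|by constructor 3].
(* So far the path has used no edge inside either box, so [x] is touched from outside the first one.
   The inner path from [x] to [t] is outer for the second box by disjointness. *)
have [ic|nc] := boolP (inside c n e).
  have bx : box c n x by move: ic; rewrite (inside_joins _ _ xz) => /andP[].
  have [eyx|[_ tx]] := vconn_touched yxc; first by rewrite eyx bx in nyc.
  constructor 2; apply: vconn_trans yxd _.
  apply: vconn_mono (cc _ _ bx bt tx tt) => f /andP[pf /disj nf].
  by rewrite /outer pf.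
have [id|nd] := boolP (inside d n e).
  have bx : box d n x by move: id; rewrite (inside_joins _ _ xz) => /andP[].
  have [eyx|[_ tx]] := vconn_touched yxd; first by rewrite eyx bx in nyd.
  constructor 3; apply: vconn_trans yxc _.
  apply: vconn_mono (cd _ _ bx bt' tx tt') => f /andP[pf nf].
  by rewrite /outer pf; apply: contraL nf; exact: disj.
by constructor 1; split; apply: vconn_step xz => //; rewrite /outer pe.
Qed.

Lemma encounters_bound (psi : L1edge -> bool) (n R : nat) (s : seq L1vert) :
  (0 < R)%N -> uniq s ->
  (forall c v, c \in s -> box c n v -> box (0, 0) R.-1 v) ->
  (forall c d v, c \in s -> d \in s -> c != d -> box c n v -> ~~ box d n v) ->
  (forall c, c \in s -> encounter c n psi) ->
  (size s <= 4 * (R + R).+1)%N.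
Proof.
move=> R0 us sR sdisj sE; rewrite -size_sphere.
(* [hub c] restricts the domain of [P c] to the cluster of the box. *)
pose hub c y := exists2 u, box c n u /\ touched (outer c n psi) u & vconn psi u y.
pose P c y y' := vconn (outer c n psi) y y' /\ hub c y.
apply: (@compatible_tripartitions_bound _ _ P) => //.
- move=> c a b [ab [u hu ua]]; split; first exact: vconn_sym.
  by exists u => //; apply: vconn_trans ua _; exact: vconn_outer ab.
- by move=> c a b d [ab ha] [bd _]; split=> //; exact: vconn_trans bd.
- move=> c cs; have [_ [u1 [u2 [u3 [[b1 b2 b3] [i1 i2 i3] [n12 n13 n23]]]]]] := sE c cs.
  have [y1 y1S uy1] := in_infinite_sphere R0 (sR _ _ cs b1) i1.
  have [y2 y2S uy2] := in_infinite_sphere R0 (sR _ _ cs b2) i2.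
  have [y3 y3S uy3] := in_infinite_sphere R0 (sR _ _ cs b3) i3.
  have loop u y : box c n u -> in_infinite (outer c n psi) u -> vconn (outer c n psi) u y ->
    P c y y.
    move=> bu iu uy; split; first exact: vconn_refl.
    exists u; last exact: vconn_outer uy.
    by split=> //; exact: in_infinite_touched.
  have sep u v y z : vconn (outer c n psi) u y -> vconn (outer c n psi) v z ->
      ~ vconn (outer c n psi) u v -> ~ P c y z.
    move=> uy vz nuv [yz _]; apply: nuv; apply: vconn_trans uy _.
    by apply: vconn_trans yz _; exact: vconn_sym.
  exists y1, y2, y3; split=> //; split.
  + exact: loop b1 i1 uy1.
  + exact: loop b2 i2 uy2.
  + exact: loop b3 i3 uy3.
  + exact: sep uy1 uy2 n12.
  + exact: sep uy1 uy3 n13.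
  + exact: sep uy2 uy3 n23.
- move=> c d y cs ds cd [_ [t [bt tt] ty]] [_ [t' [bt' tt'] ty']].
  (* The first class is the branch at [c] that leads to [d], the second the branch at [d] that leads
     to [c]. *)
  exists (fun z => vconn (outer c n psi) z t' /\ hub c z),
         (fun z => vconn (outer d n psi) z t /\ hub d z); split.
  + move=> z zS hz.
    (* The common point [y] puts both boxes in the same cluster, so [z] is connected to both. *)
    have tz : vconn psi t z.
      case: hz => -[_ [u [bu tu] uz]].
        by apply: vconn_trans uz; apply: (@vconn_inner c n); apply: (sE c cs).1.
      apply: vconn_trans uz; apply: vconn_trans ty _.
      apply: vconn_trans (vconn_sym ty') _.
      by apply: (@vconn_inner d n); apply: (sE d ds).1.
    have tz' : vconn psi t' z.
      by apply: vconn_trans ty' _; apply: vconn_trans (vconn_sym ty) _.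
    have hc : hub c z by exists t.
    have hd : hub d z by exists t'.
    have out e : e \in s -> ~~ box e n z.
      move=> es; apply/negP => /(sR _ _ es); apply/negP.
      by apply: sphere_outside zS _; rewrite prednK.
    have disj e : inside c n e -> ~~ inside d n e.
      by rewrite /inside => /andP[/(sdisj _ _ _ cs ds cd)/negPf->].
    have [[zt _]|zt|zt] := vconn_two_boxes disj (sE c cs).1 (sE d ds).1 bt tt bt' tt'
      (out _ cs) (out _ ds) (vconn_sym tz').
    * by left.
    * by right.
    * by left.
  + by move=> a b [at' ha] [bt'' _]; split=> //; apply: vconn_trans at' _; exact: vconn_sym.
  + by move=> a b [at' ha] [bt'' _]; split=> //; apply: vconn_trans at' _; exact: vconn_sym.
Qed.

(** * Merging the clusters that meet a box *)

Definition flips (s : seq L1vert) (psi : EdgeConfig) : EdgeConfig := foldr flip psi s.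

Definition even_degrees (psi : L1edge -> bool) : Prop := forall i j : int,
  psi (i, j, Hor) (+) psi (i - 1, j, Hor) (+) psi (i, j, Ver) (+) psi (i, j - 1, Ver) = false.

(* The two faces on either side of an edge, faces being indexed by their
   lower-left corner. *)
Definition faces (e : L1edge) : L1vert * L1vert :=
  let: (i, j, d) := e in
  match d with Hor => ((i, j), (i, j - 1)) | Ver => ((i, j), (i - 1, j)) end.

Lemma side_of_faces s e : side_of s e = (s == (faces e).1) (+) (s == (faces e).2).
Proof.
case: s e => [i j] [[a b] []]; rewrite /side_of /= !xpair_eqE /=.
  by rewrite !andbT !andbF !orbF; lia.
by rewrite !andbT !andbF /=; lia.
Qed.

Lemma faces_neq e : ((faces e).1 == (faces e).2) = false.
Proof. by case: e => [[a b] []] /=; rewrite xpair_eqE; lia. Qed.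

Lemma flipsE s psi e : uniq s ->
  flips s psi e = psi e (+) ((faces e).1 \in s) (+) ((faces e).2 \in s).
Proof.
rewrite /flips; elim: s => [|f s IH] /=; first by rewrite !addbF.
move=> /andP[fs us]; rewrite /flip side_of_faces !inE (IH us).
rewrite ![f == _]eq_sym.
have [e1|_] := eqVneq (faces e).1 f; have [e2|_] := eqVneq (faces e).2 f => //=.
- by have := faces_neq e; rewrite e1 e2 eqxx.
- by rewrite e1 (negPf fs); case: (psi e); case: (_ \in s).
- by rewrite e2 (negPf fs); case: (psi e); case: (_ \in s).
Qed.

(** Each face borders none or two of the four edges at a vertex. *)
Lemma flips_even s psi : uniq s -> even_degrees psi -> even_degrees (flips s psi).
Proof.
move=> us ev i j; move: (ev i j); rewrite !flipsE //=.
by case: (psi (i, j, Hor)); case: (psi (i - 1, j, Hor)); case: (psi (i, j, Ver));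
  case: (psi (i, j - 1, Ver)) => //=; do 4!case: (_ \in s).
Qed.

(** * Spins on the faces of a box, and the checkerboard *)

Section Spin.
Variables (psi : L1edge -> bool) (n : nat).

(** Index [(a, b)] stands for the face [(a - n, b - n)]. From the lower-left face, the spin changes
    at each present edge crossed along the bottom row, then up the column. *)
Fixpoint spin_row (a : nat) : bool :=
  if a is a'.+1 then spin_row a' (+) psi (a%:Z - n%:Z, - n%:Z, Ver) else false.

Fixpoint spin (a b : nat) : bool :=
  if b is b'.+1 then spin a b' (+) psi (a%:Z - n%:Z, b%:Z - n%:Z, Hor) else spin_row a.

(** Even degree makes the four changes of spin around a vertex cancel, which carries the property
    from one row of faces to the next. *)
Lemma spin_ver a b : even_degrees psi ->
  spin a b (+) spin a.+1 b = psi (a.+1%:Z - n%:Z, b%:Z - n%:Z, Ver).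
Proof.
move=> ev; elim: b => [|b IH] /=; first by rewrite sub0r addbA addbb addFb.
have := ev (a.+1%:Z - n%:Z) (b.+1%:Z - n%:Z).
have -> : a.+1%:Z - n%:Z - 1 = a%:Z - n%:Z by lia.
have -> : b.+1%:Z - n%:Z - 1 = b%:Z - n%:Z by lia.
rewrite -{}IH.
case: (psi (a.+1%:Z - n%:Z, b.+1%:Z - n%:Z, Hor));
  case: (psi (a%:Z - n%:Z, b.+1%:Z - n%:Z, Hor)); case: (psi (_, _, Ver));
  by case: (spin a b); case: (spin a.+1 b).
Qed.

(** The difference between the spins and a checkerboard. On the faces of the box the arguments of
    [absz] are nonnegative. *)
Definition parity_spin (f : L1vert) : bool :=
  let a := absz (f.1 + n%:Z)%R in let b := absz (f.2 + n%:Z)%R in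
  spin a b (+) odd (a + b).

(* The phase of the checkerboard in the quadrant [(p, q)] is the one for which
   the horizontal edge at the corner of the box in that quadrant is present. *)
Definition phase (p q : bool) : bool :=
  let i := if p then n%:Z - 1 else - n%:Z in
  ~~ (psi (i, if q then n%:Z else - n%:Z, Hor) (+)
      parity_spin (i, if q then n%:Z - 1 else - n%:Z)).

Definition flipped (f : L1vert) : bool :=
  parity_spin f (+) phase (0 <= f.1) (0 <= f.2).

Definition box_faces : seq L1vert :=
  [seq ((a : nat)%:Z - n%:Z, (b : nat)%:Z - n%:Z) | a <- iota 0 (n + n), b <- iota 0 (n + n)].

Definition flip_set : seq L1vert := undup [seq f <- box_faces | flipped f].

Lemma mem_flip_set f : (f \in flip_set) =
  [&& - n%:Z <= f.1, f.1 < n%:Z, - n%:Z <= f.2, f.2 < n%:Z & flipped f].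
Proof.
rewrite mem_undup mem_filter andbC !andbA; congr (_ && _).
apply/allpairsP/idP => [[[a b] /= []]|].
  by rewrite !mem_iota => ? ? -> /=; lia.
move=> h; exists (absz (f.1 + n%:Z)%R, absz (f.2 + n%:Z)%R) => /=.
case: f h => x y /= h; rewrite !mem_iota; split; [lia|lia|congr (_, _); lia].
Qed.

(** Neighbouring faces of one quadrant end up with opposite spins: inside the box, only edges on the
    axes or on the boundary may be absent. *)
Definition merged : EdgeConfig := flips flip_set psi.

Lemma mergedE e : merged e =
  psi e (+) ((faces e).1 \in flip_set) (+) ((faces e).2 \in flip_set).
Proof. by rewrite /merged flipsE // undup_uniq. Qed.

Lemma merged_outer e : ~~ inside (0, 0) n e -> merged e = psi e.
Proof.
rewrite mergedE /inside /box; case: e => [[i j] []] /= h;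
  rewrite [_ \in _]mem_flip_set /= [X in _ (+) X]mem_flip_set /=; lia.
Qed.

(** The faces beside the edge are in the same quadrant, so their phases cancel, while their
    checkerboard parities differ. *)
Lemma merged_hor (i j : int) : - n%:Z <= i -> i < n%:Z -> (0 < absz j < n)%N ->
  merged (i, j, Hor).
Proof.
move=> i1 i2 hj; rewrite mergedE /= !mem_flip_set /=.
rewrite /flipped /= /parity_spin /=.
have -> : (0 <= j - 1) = (0 <= j) by lia.
have [a ea] : exists a : nat, i = a%:Z - n%:Z by exists (absz (i + n%:Z)%R); lia.
have [b eb] : exists b : nat, j = b.+1%:Z - n%:Z by exists (absz (j + n%:Z - 1)%R); lia.
have -> : absz (i + n%:Z)%R = a by lia.
have -> : absz (j + n%:Z)%R = b.+1 by lia.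
have -> : absz (j - 1 + n%:Z)%R = b by lia.
have -> : - n%:Z <= i by []. have -> : i < n%:Z by [].
have -> : - n%:Z <= j by lia. have -> : j < n%:Z by lia.
have -> : - n%:Z <= j - 1 by lia. have -> : j - 1 < n%:Z by lia.
rewrite /= addnS /= -ea -eb.
by case: (psi _); case: (spin a b); case: (odd _); case: (phase _ _).
Qed.

Lemma merged_ver (i j : int) : even_degrees psi ->
  - n%:Z <= j -> j < n%:Z -> (0 < absz i < n)%N -> merged (i, j, Ver).
Proof.
move=> ev j1 j2 hi; rewrite mergedE /= !mem_flip_set /=.
rewrite /flipped /= /parity_spin /=.
have -> : (0 <= i - 1) = (0 <= i) by lia.
have [a ea] : exists a : nat, i = a.+1%:Z - n%:Z by exists (absz (i + n%:Z - 1)%R); lia.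
have [b eb] : exists b : nat, j = b%:Z - n%:Z by exists (absz (j + n%:Z)%R); lia.
have -> : absz (i + n%:Z)%R = a.+1 by lia.
have -> : absz (j + n%:Z)%R = b by lia.
have -> : absz (i - 1 + n%:Z)%R = a by lia.
have -> : - n%:Z <= j by []. have -> : j < n%:Z by [].
have -> : - n%:Z <= i by lia. have -> : i < n%:Z by lia.
have -> : - n%:Z <= i - 1 by lia. have -> : i - 1 < n%:Z by lia.
rewrite {1}ea {1}eb -spin_ver // addSn /=.
by case: (spin a b); case: (spin a.+1 b); case: (odd _); case: (phase _ _).
Qed.

(** Both inside edges at a corner lie on the boundary of the box and could be absent together;
    choosing a phase for each quadrant rules this out. *)
Lemma merged_corner (p q : bool) : (1 < n)%N ->
  merged (if p then n%:Z - 1 else - n%:Z, if q then n%:Z else - n%:Z, Hor).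
Proof.
move=> n1; rewrite mergedE /= !mem_flip_set /=.
rewrite /flipped.
case: p; case: q => /=.
- rewrite ltxx !andbF addbF.
  have -> : 0 <= n%:Z - 1 by lia.
  have -> : - n%:Z <= n%:Z - 1 by lia. have -> : n%:Z - 1 < n%:Z by lia.
  rewrite /phase /=; by case: (psi _); case: (parity_spin _).
- have -> : 0 <= n%:Z - 1 by lia. have -> : (0 <= - n%:Z) = false by lia.
  have -> : - n%:Z <= n%:Z - 1 by lia. have -> : n%:Z - 1 < n%:Z by lia.
  have -> : - n%:Z <= - n%:Z by lia. have -> : - n%:Z < n%:Z by lia.
  have -> : - n%:Z <= - n%:Z - 1 = false by lia.
  rewrite /phase /=; by case: (psi _); case: (parity_spin _).
- rewrite ltxx !andbF addbF.
  have -> : 0 <= n%:Z - 1 by lia. have -> : (0 <= - n%:Z) = false by lia.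
  have -> : - n%:Z <= n%:Z - 1 by lia. have -> : n%:Z - 1 < n%:Z by lia.
  have -> : - n%:Z <= - n%:Z by lia. have -> : - n%:Z < n%:Z by lia.
  rewrite /phase /=; by case: (psi _); case: (parity_spin _).
- have -> : (0 <= - n%:Z) = false by lia.
  have -> : - n%:Z <= - n%:Z by lia. have -> : - n%:Z < n%:Z by lia.
  have -> : - n%:Z <= - n%:Z - 1 = false by lia.
  rewrite /phase /=; by case: (psi _); case: (parity_spin _).
Qed.

Lemma merged_even : even_degrees psi -> even_degrees merged.
Proof. by apply: flips_even; exact: undup_uniq. Qed.

End Spin.

(** Propagation both ways from [1], because the vertex [(1, 1)], off the axes, is the base point
    below. *)
Lemma absz_line (P : int -> Prop) (n : nat) (x : int) :
  (forall i : int, - n%:Z <= i -> i < n%:Z -> P i <-> P (i + 1)) ->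
  P 1 -> (0 < n)%N -> (absz x <= n)%N -> P x.
Proof.
move=> step P1 n0 hx.
have up k : (1 + k <= n)%N -> P (1 + k)%:Z.
  elim: k => [//|k IH] hk; have := IH ltac:(lia).
  rewrite (step (1 + k)%:Z); [|lia|lia].
  by have -> : (1 + k)%:Z + 1 = (1 + k.+1)%:Z by lia.
have dn k : (k <= n.+1)%N -> P (1 - k%:Z).
  elim: k => [//|k IH] hk; have := IH ltac:(lia).
  rewrite [X in _ -> X](step (1 - k.+1%:Z)); [|lia|lia].
  by have -> : 1 - k.+1%:Z + 1 = 1 - k%:Z by lia.
have [x1|x1] := leP 1 x.
  have -> : x = (1 + absz (x - 1)%R)%N%:Z by lia.
  by apply: up; lia.
have -> : x = 1 - (absz (1 - x)%R)%:Z by lia.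
by apply: dn; lia.
Qed.

(** Rows and columns off the axes and the boundary are entirely present, and they cross. There
    remain the corners, the ends of the axes and the origin. *)
Lemma merged_connected psi n u v : (1 < n)%N -> even_degrees psi ->
  box (0, 0) n u -> box (0, 0) n v ->
  touched (outer (0, 0) n (merged psi n)) u -> touched (outer (0, 0) n (merged psi n)) v ->
  vconn (inner (0, 0) n (merged psi n)) u v.
Proof.
move=> n1 ev bu bv tu tv.
suff good w : box (0, 0) n w -> touched (outer (0, 0) n (merged psi n)) w ->
    vconn (inner (0, 0) n (merged psi n)) w (1, 1).
  by apply: vconn_trans (good u bu tu) _; apply/vconn_sym/good.
move=> {u v bu bv tu tv}.
set q := merged psi n; have evq : even_degrees q by exact: merged_even.
have insE e : q e -> inside (0, 0) n e -> inner (0, 0) n q e by move=> *; apply/andP.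
have row b x : (0 < absz b < n)%N -> (absz x <= n)%N -> vconn (inner (0, 0) n q) (x, b) (1, b).
  move=> hb hx.
  apply: (absz_line (P := fun x => vconn (inner (0, 0) n q) (x, b) (1, b)) (n := n)) => //;
    [|exact: vconn_refl|lia].
  move=> i i1 i2.
  have e : vconn (inner (0, 0) n q) (i, b) (i + 1, b).
    apply: (@vconn_edge _ (i, b, Hor)); last by left.
    by apply: insE; [exact: merged_hor|rewrite /inside /box /=; lia].
  by split; apply: vconn_trans => //; exact: vconn_sym.
have col a y : (0 < absz a < n)%N -> (absz y <= n)%N -> vconn (inner (0, 0) n q) (a, y) (a, 1).
  move=> ha hy.
  apply: (absz_line (P := fun y => vconn (inner (0, 0) n q) (a, y) (a, 1)) (n := n)) => //;
    [|exact: vconn_refl|lia].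
  move=> i i1 i2.
  have e : vconn (inner (0, 0) n q) (a, i) (a, i + 1).
    apply: (@vconn_edge _ (a, i, Ver)); last by left.
    by apply: insE; [exact: merged_ver|rewrite /inside /box /=; lia].
  by split; apply: vconn_trans => //; exact: vconn_sym.
have grow x y : (absz x <= n)%N -> (0 < absz y < n)%N -> vconn (inner (0, 0) n q) (x, y) (1, 1).
  by move=> hx hy; apply: (vconn_trans (row y x hy hx)); apply: col => //; lia.
have gcol x y : (absz y <= n)%N -> (0 < absz x < n)%N -> vconn (inner (0, 0) n q) (x, y) (1, 1).
  by move=> hy hx; apply: (vconn_trans (col x y hx hy)); apply: row => //; lia.
case: w => x y bxy [e /andP[qe noute] ue].
have [hx hy] : (absz x <= n)%N /\ (absz y <= n)%N by move: bxy; rewrite /box /=; lia.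
have [h|h] := boolP (0 < absz y < n)%N; first exact: grow.
have [h'|h'] := boolP (0 < absz x < n)%N; first exact: gcol.
have step e' v : q e' -> joins e' (x, y) v -> inside (0, 0) n e' ->
    vconn (inner (0, 0) n q) v (1, 1) -> vconn (inner (0, 0) n q) (x, y) (1, 1).
  move=> qe' j ie; apply: vconn_trans; apply: vconn_edge j; exact: insE.
have corner (p r : bool) : x = (if p then n%:Z else - n%:Z) ->
    y = (if r then n%:Z else - n%:Z) -> vconn (inner (0, 0) n q) (x, y) (1, 1).
  move=> ex ey; have := merged_corner psi p r n1; rewrite -ey => qc.
  apply: (step _ (if p then n%:Z - 1 else - n%:Z + 1, y) qc).
  - by rewrite ex; case: (p); [right; rewrite /= subrK|left].
  - by rewrite /inside /box /= ey; case: (p); case: (r); lia.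
  - by apply: gcol => //; case: (p); lia.
have [y0|y0] := eqVneq y 0; last first.
  have [x0|x0] := eqVneq x 0; last first.
    by apply: (corner (0 <= x) (0 <= y)); case: ifP; lia.
  (* At the end of an axis the only outer edge prolongs the axis. Even degree gives another present
     edge there, whose other end is on a complete row or column. *)
  have qo : q (0, if 0 <= y then y else y - 1, Ver).
    suff <- : e = (0, if 0 <= y then y else y - 1, Ver) by [].
    move: e ue noute {qe} => [[a b] []]; rewrite /inside /box /incident /= => -[] [*];
      first [by exfalso; lia|by congr (_, _, _); first [lia|case: ifP; lia]].
  have := evq 0 y; move: qo; subst x.
  have [ey|ey] : y = n%:Z \/ y = - n%:Z by lia.
  - have -> : (0 <= y) by lia.
    move=> ->; case q1 : (q (0, y, Hor)).
      move=> _; apply: (step _ (1, y) q1); [by left|rewrite /inside /box /=; lia|].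
      by apply: gcol => //; lia.
    case q2 : (q (0 - 1, y, Hor)).
      move=> _; apply: (step _ (-1, y) q2); [by right|rewrite /inside /box /=; lia|].
      by apply: gcol => //; lia.
    case q3 : (q (0, y - 1, Ver)) => // _.
    apply: (step _ (0, y - 1) q3); [by right; rewrite /= subrK|rewrite /inside /box /=; lia|].
    by apply: grow; lia.
  - have -> : (0 <= y) = false by lia.
    move=> ->; case q1 : (q (0, y, Hor)).
      move=> _; apply: (step _ (1, y) q1); [by left|rewrite /inside /box /=; lia|].
      by apply: gcol => //; lia.
    case q2 : (q (0 - 1, y, Hor)).
      move=> _; apply: (step _ (-1, y) q2); [by right|rewrite /inside /box /=; lia|].
      by apply: gcol => //; lia.
    case q3 : (q (0, y, Ver)) => // _.
    apply: (step _ (0, y + 1) q3); [by left|rewrite /inside /box /=; lia|].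
    by apply: grow; lia.
subst y; have qo : q (if 0 <= x then x else x - 1, 0, Hor).
  suff <- : e = (if 0 <= x then x else x - 1, 0, Hor) by [].
  move: e ue noute {qe} => [[a b] []]; rewrite /inside /box /incident /= => -[] [*];
    first [by exfalso; lia|by congr (_, _, _); first [lia|case: ifP; lia]].
have := evq x 0; move: qo.
have [ex|[ex|ex]] : x = n%:Z \/ x = - n%:Z \/ absz x != n by lia.
- have -> : (0 <= x) by lia.
  move=> ->; case q1 : (q (x - 1, 0, Hor)).
    move=> _; apply: (step _ (x - 1, 0) q1); [by right;
      rewrite /= subrK|rewrite /inside /box /=; lia|].
    by apply: gcol; lia.
  case q2 : (q (x, 0, Ver)).
    move=> _; apply: (step _ (x, 1) q2); [by left|rewrite /inside /box /=; lia|].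
    by apply: grow => //; lia.
  case q3 : (q (x, 0 - 1, Ver)) => // _.
  apply: (step _ (x, -1) q3); [by right|rewrite /inside /box /=; lia|].
  by apply: grow => //; lia.
- have -> : (0 <= x) = false by lia.
  move=> ->; case q1 : (q (x, 0, Hor)).
    move=> _; apply: (step _ (x + 1, 0) q1); [by left|rewrite /inside /box /=; lia|].
    by apply: gcol; lia.
  case q2 : (q (x, 0, Ver)).
    move=> _; apply: (step _ (x, 1) q2); [by left|rewrite /inside /box /=; lia|].
    by apply: grow => //; lia.
  case q3 : (q (x, 0 - 1, Ver)) => // _.
  apply: (step _ (x, -1) q3); [by right|rewrite /inside /box /=; lia|].
  by apply: grow => //; lia.
(* The origin has no outer edge. *)
- exfalso; move: e ue noute {qe} => [[a b] []]; rewrite /inside /box /incident /= => -[] [*]; lia.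
Qed.

(** * Infinite clusters that meet a box *)

Definition at_most_one_infinite (psi : L1edge -> bool) : Prop :=
  forall u v, in_infinite psi u -> in_infinite psi v -> vconn psi u v.

Definition at_most_two_infinite (psi : L1edge -> bool) : Prop :=
  forall u v w, in_infinite psi u -> in_infinite psi v -> in_infinite psi w ->
    vconn psi u v \/ vconn psi u w \/ vconn psi v w.

Definition box_vertices (n : nat) : seq L1vert :=
  [seq ((a : nat)%:Z - n%:Z, (b : nat)%:Z - n%:Z) | a <- iota 0 (n + n).+1, b <- iota 0 (n + n).+1].

Lemma mem_box_vertices n v : box (0, 0) n v -> v \in box_vertices n.
Proof.
case: v => x y; rewrite /box /= => h; apply/allpairsP.
exists (absz (x + n%:Z)%R, absz (y + n%:Z)%R).
by split; rewrite ?mem_iota /=; [lia|lia|congr (_, _); lia].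
Qed.

Lemma box_mono m m' v : (m <= m')%N -> box (0, 0) m v -> box (0, 0) m' v.
Proof. by rewrite /box /=; lia. Qed.

Lemma common_box (P : L1vert -> Prop) (Q : L1vert -> L1vert -> Prop) (s : seq L1vert) :
  (forall b, b \in s -> P b -> exists m, forall v, Q b v -> box (0, 0) m v) ->
  exists m, forall b v, b \in s -> P b -> Q b v -> box (0, 0) m v.
Proof.
elim: s => [|c s IH] h; first by exists 0%N.
have [|m hm] := IH; first by move=> b bs; apply: h; rewrite inE bs orbT.
have [pc|npc] := pselect (P c).
  have [m' hm'] := h c (mem_head _ _) pc.
  exists (maxn m m') => b v; rewrite inE => /orP[/eqP-> _ /hm'|bs pb /(hm _ _ bs pb)].
    by apply: box_mono; exact: leq_maxr.
  by apply: box_mono; exact: leq_maxl.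
by exists m => b v; rewrite inE => /orP[/eqP-> /npc|bs]; [|exact: hm].
Qed.

(** Otherwise the outer clusters of the finitely many box vertices connected to [c] would all fit in
    one box, whereas every path from [c] ends in one of them. *)
Lemma in_infinite_outer_exists psi n c : box (0, 0) n c -> in_infinite psi c ->
  exists2 b, box (0, 0) n b & vconn psi c b /\ in_infinite (outer (0, 0) n psi) b.
Proof.
move=> bc ic; apply: contrapT => none.
have [b _ cb|m hm] := @common_box (fun b => box (0, 0) n b /\ vconn psi c b)
    (vconn (outer (0, 0) n psi)) (box_vertices n).
  apply: contrapT => unb; apply: none; exists b; first exact: cb.1.
  split; first exact: cb.2.
  move=> m; apply: contrapT => hm; apply: unb; exists m => v bv.
  by apply: contrapT => /negP nbv; apply: hm; exists v.
have [v cv /negP] := ic m; apply.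
suff [b [bb cb] bv] : exists2 b, box (0, 0) n b /\ vconn psi c b & vconn (outer (0, 0) n psi) b v.
  by apply: (hm b) bv => //; exact: mem_box_vertices.
(* [b] is where the path last used an edge inside the box, or [c] itself. *)
elim: cv => [|x y e cx [b [bb cb] bx] pe xy].
  by exists c; [split=> //|]; exact: vconn_refl.
have [ie|ne] := boolP (inside (0, 0) n e).
  exists y; last exact: vconn_refl.
  split; last exact: vconn_step cx pe xy.
  by move: ie; rewrite (inside_joins _ _ xy) => /andP[].
by exists b => //; apply: vconn_step bx _ xy; rewrite /outer pe.
Qed.

Lemma outer_merged psi n : outer (0, 0) n (merged psi n) = outer (0, 0) n psi.
Proof.
apply/funext => e; rewrite /outer; have [|ne] := boolP (inside (0, 0) n e); first by rewrite !andbF.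
by rewrite merged_outer.
Qed.

Lemma exists_box (u v w : L1vert) :
  exists2 n, (1 < n)%N & [/\ box (0, 0) n u, box (0, 0) n v & box (0, 0) n w].
Proof.
exists (2 + (absz u.1 + absz u.2) + (absz v.1 + absz v.2) + (absz w.1 + absz w.2))%N; first by lia.
by rewrite /box /=; split; lia.
Qed.

(** In a box meeting three infinite clusters, each keeps an infinite outer part, and merging does
    not change the outer edges. *)
Lemma many_in_infinite_encounter psi : even_degrees psi -> ~ at_most_two_infinite psi ->
  exists n s, encounter (0, 0) n (flips s psi).
Proof.
move=> ev /existsNP[u1 /existsNP[u2 /existsNP[u3 ]]].
move=> /not_implyP[i1 /not_implyP[i2 /not_implyP[i3]]].
move=> /not_orP[n12 /not_orP[n13 n23]].
have [n n1 [b1 b2 b3]] := exists_box u1 u2 u3.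
exists n, (flip_set psi n); rewrite -/(merged psi n); split.
  by move=> u v bu bv; exact: merged_connected.
rewrite outer_merged.
have [v1 bv1 [uv1 iv1]] := in_infinite_outer_exists b1 i1.
have [v2 bv2 [uv2 iv2]] := in_infinite_outer_exists b2 i2.
have [v3 bv3 [uv3 iv3]] := in_infinite_outer_exists b3 i3.
have sep x y a b : vconn psi x a -> vconn psi y b -> ~ vconn psi x y ->
    ~ vconn (outer (0, 0) n psi) a b.
  move=> xa yb nxy /vconn_outer ab; apply: nxy.
  by apply: vconn_trans xa _; apply: vconn_trans ab _; exact: vconn_sym.
exists v1, v2, v3; do !split=> //.
- exact: sep uv1 uv2 n12.
- exact: sep uv1 uv3 n13.
- exact: sep uv2 uv3 n23.
Qed.

Lemma vconn_agree_outer n (phi phi' : L1edge -> bool) x v :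
  (forall e, ~~ inside (0, 0) n e -> phi e -> phi' e) -> vconn phi x v ->
  vconn phi' x v \/ exists2 b, box (0, 0) n b & vconn phi' x b.
Proof.
move=> agree; elim=> [|y z e _ [xy|?] pe yz]; [by left; exact: vconn_refl| |by right].
have [|ne] := boolP (inside (0, 0) n e).
  by rewrite (inside_joins _ _ yz) => /andP[by' _]; right; exists y.
by left; apply: vconn_step xy _ yz; exact: agree.
Qed.

(** Some edge of the path has exactly one end in the box, hence is outer. *)
Lemma vconn_crosses_box n (phi : L1edge -> bool) x v : vconn phi x v ->
  box (0, 0) n x != box (0, 0) n v ->
  exists2 b, box (0, 0) n b & touched (outer (0, 0) n phi) b /\ vconn phi x b.
Proof.
elim=> [|y z e xy IH pe yz]; first by rewrite eqxx.
have [->|/IH//] := eqVneq (box (0, 0) n x) (box (0, 0) n y) => neq.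
have oe : outer (0, 0) n phi e.
  by rewrite /outer pe (inside_joins _ _ yz); case: (box _ n y) neq; case: (box _ n z).
have [b|b] := boolP (box (0, 0) n y).
  exists y => //; split=> //; exists e => //; exact: joins_incidentl yz.
exists z; first by move: neq; rewrite (negPf b); case: (box _ n z).
by split; [exists e => //; exact: joins_incidentr yz|exact: vconn_step xy pe yz].
Qed.

(** Take a box meeting both infinite clusters. After merging, an infinite cluster that missed the
    box would already be one of [psi], hence a third; so all of them meet the box and are joined
    there. *)
Lemma two_in_infinite_merge psi : even_degrees psi -> at_most_two_infinite psi ->
  ~ at_most_one_infinite psi -> exists s, at_most_one_infinite (flips s psi).
Proof.
move=> ev two /existsNP[u1 /existsNP[u2 /not_implyP[i1 /not_implyP[i2 n12]]]].
have [n n1 [b1 b2 _]] := exists_box u1 u2 u1.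
exists (flip_set psi n); rewrite -/(merged psi n).
suff hit x : in_infinite (merged psi n) x -> exists2 b, box (0, 0) n b &
    touched (outer (0, 0) n (merged psi n)) b /\ vconn (merged psi n) x b.
  move=> x y /hit[b bb [tb xb]] /hit[c bc [tc yc]].
  apply: vconn_trans xb _; apply: vconn_trans (vconn_sym yc).
  exact/vconn_inner/merged_connected.
move=> ix; have [bx|nbx] := boolP (box (0, 0) n x).
  have [v xv nbv] := ix n.
  by apply: (vconn_crosses_box xv); rewrite bx (negPf nbv).
suff [b bb xb] : exists2 b, box (0, 0) n b & vconn (merged psi n) x b.
  by apply: (vconn_crosses_box xb); rewrite bb (negPf nbx).
apply: contrapT => miss.
have ix' : in_infinite psi x.
  move=> m; have [v xv mv] := ix m; exists v => //.
  elim: xv {mv} => [|y z e xy IH pe yz]; first exact: vconn_refl.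
  apply: (vconn_step IH _ yz); rewrite -(@merged_outer psi n) //.
  by apply/negP; rewrite (inside_joins _ _ yz) => /andP[b _]; apply: miss; exists y.
have reach u : box (0, 0) n u -> ~ vconn psi x u.
  move=> bu xu; apply: miss.
  have [e ne pe|xu'|//] := @vconn_agree_outer n psi (merged psi n) x u _ xu.
    by rewrite merged_outer.
  by exists u.
by have [/reach|[/reach|]] := two _ _ _ ix' i1 i2; auto.
Qed.

(** * Measurability *)

(** Stated on predicates, measurability is derived by following the logical connectives. *)
Definition mpred (I : Type) (P : (I -> bool) -> Prop) : Prop :=
  measurable ([set f | P f] : set (g_sigma_algebraType (@cylinders I))).

Section Mset.
Variable I : Type.
Implicit Types P Q : (I -> bool) -> Prop.

Lemma mpred_ext P Q : (forall f, P f <-> Q f) -> mpred P -> mpred Q.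
Proof. by move=> PQ; congr (measurable _); apply/seteqP; split=> f /PQ. Qed.

Lemma mpred_coord (i : I) : mpred (fun f => f i).
Proof. by apply: sub_sigma_algebra; exists i, true. Qed.

Lemma mpred_not P : mpred P -> mpred (fun f => ~ P f).
Proof. exact: measurableC. Qed.

Lemma mpred_and P Q : mpred P -> mpred Q -> mpred (fun f => P f /\ Q f).
Proof. exact: measurableI. Qed.

Lemma mpred_or P Q : mpred P -> mpred Q -> mpred (fun f => P f \/ Q f).
Proof. exact: measurableU. Qed.

Lemma mpred_const (A : Prop) : mpred (fun _ : I -> bool => A).
Proof.
have [a|na] := pselect A.
  by apply: (mpred_ext (P := fun _ : I -> bool => True)) => //; exact: measurableT.
by apply: (mpred_ext (P := fun _ : I -> bool => False)) => //; exact: measurable0.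
Qed.

Lemma mpred_imply P Q : mpred P -> mpred Q -> mpred (fun f => P f -> Q f).
Proof.
move=> mP mQ; apply: mpred_ext (mpred_or (mpred_not mP) mQ) => f.
by have [p|np] := pselect (P f); split=> //; [case|right; auto|left].
Qed.

Lemma mpred_ex (T : countType) (P : T -> (I -> bool) -> Prop) :
  (forall t, mpred (P t)) -> mpred (fun f => exists t, P t f).
Proof.
move=> mP; have := @countable_bigcupT_measurable _ (g_sigma_algebraType (@cylinders I)) T
  (fun t => [set f | P t f]) (countableP _) mP.
by congr (measurable _); apply/seteqP; split=> f [t]; exists t.
Qed.

Lemma mpred_all (T : countType) (P : T -> (I -> bool) -> Prop) :
  (forall t, mpred (P t)) -> mpred (fun f => forall t, P t f).
Proof.
move=> mP; apply: mpred_ext (mpred_not (mpred_ex (fun t => mpred_not (mP t)))) => f.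
by split=> [h t|h [t]//]; apply: contrapT => nP; apply: h; exists t.
Qed.

Lemma mpred_eqb (f g : (I -> bool) -> bool) : mpred (fun h => f h) -> mpred (fun h => g h) ->
  mpred (fun h => f h == g h).
Proof.
move=> mf mg; apply: mpred_ext (mpred_and (mpred_imply mf mg) (mpred_imply mg mf)) => h.
split=> [[fg gf]|/eqP->//]; apply/eqP; exact/idP/idP.
Qed.

Lemma mpred_andb (f g : (I -> bool) -> bool) : mpred (fun h => f h) -> mpred (fun h => g h) ->
  mpred (fun h => f h && g h).
Proof.
move=> mf mg; apply: mpred_ext (mpred_and mf mg) => h.
by split=> [[-> ->]|/andP].
Qed.

Lemma mpred_orb (f g : (I -> bool) -> bool) : mpred (fun h => f h) -> mpred (fun h => g h) ->
  mpred (fun h => f h || g h).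
Proof. by move=> mf mg; apply: mpred_ext (mpred_or mf mg) => h; split=> /orP. Qed.

Lemma mpred_negb (f : (I -> bool) -> bool) : mpred (fun h => f h) -> mpred (fun h => ~~ f h).
Proof. by move=> mf; apply: mpred_ext (mpred_not mf) => h; split=> /negP. Qed.

Lemma mpred_preimage (J : Type) (F : (I -> bool) -> J -> bool) (P : (J -> bool) -> Prop) :
  (forall j, mpred (fun f => F f j)) -> mpred P -> mpred (fun f => P (F f)).
Proof.
move=> mF mP.
have mFf : measurable_fun setT (F : g_sigma_algebraType (@cylinders I) ->
    g_sigma_algebraType (@cylinders J)).
  have := @measurability _ _ (g_sigma_algebraType (@cylinders I))
    (g_sigma_algebraType (@cylinders J)) setT F (@cylinders J) erefl; apply.
  move=> _ [_ [j [b ->]] <-]; rewrite setTI; case: b; first exact: mF.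
  by apply: mpred_ext (mpred_not (mF j)) => f; split=> [/negP/negPf//|/= ->].
by have := mFf measurableT _ mP; rewrite setTI.
Qed.

End Mset.

Lemma mpred_ex_edge (I : Type) (P : L1edge -> (I -> bool) -> Prop) :
  (forall e, mpred (P e)) -> mpred (fun f => exists e, P e f).
Proof.
move=> mP; apply: (mpred_ext (P := fun f => exists p : L1vert, P (p, Hor) f \/ P (p, Ver) f)).
  by move=> f; split=> [[p [h|h]]|[[p []] h]]; [exists (p, Hor)|exists (p, Ver)|exists p;
    left|exists p; right].
by apply: mpred_ex => p; apply: mpred_or.
Qed.

(** Fixing the length of paths makes connection a countable union of events. *)
Fixpoint vreach (psi : L1edge -> bool) (k : nat) (u v : L1vert) : Prop :=
  if k is k'.+1 then exists w, exists e, vreach psi k' u w /\ (psi e /\ joins e w v)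
  else u = v.

Lemma vconn_vreach psi u v : vconn psi u v <-> exists k, vreach psi k u v.
Proof.
split=> [|[k]].
  elim=> [|x y e _ [k kx] pe xy]; first by exists 0%N.
  by exists k.+1, x, e.
elim: k v => [v /= ->|k IH v /= [w [e [uw [pe wv]]]]]; first exact: vconn_refl.
by apply: vconn_step (IH _ uw) pe wv.
Qed.

Section MsetGraph.
Variables (I : Type) (F : (I -> bool) -> L1edge -> bool).
Hypothesis mF : forall e, mpred (fun f => F f e).

Lemma mpred_vconn u v : mpred (fun f => vconn (F f) u v).
Proof.
apply: (mpred_ext (fun f => iff_sym (vconn_vreach (F f) u v))).
apply: mpred_ex => k; elim: k v => [|k IH] v; first exact: mpred_const.
apply: mpred_ex => w; apply: mpred_ex_edge => e.
by apply: mpred_and => //; apply: mpred_and => //; exact: mpred_const.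
Qed.

Lemma mpred_in_infinite u : mpred (fun f => in_infinite (F f) u).
Proof.
apply: mpred_all => m.
apply: (mpred_ext (P := fun f => exists v, vconn (F f) u v /\ ~~ box (0, 0) m v)).
  by move=> f; split=> [[v []]|[v]]; exists v.
by apply: mpred_ex => v; apply: mpred_and; [exact: mpred_vconn|exact: mpred_const].
Qed.

Lemma mpred_touched u : mpred (fun f => touched (F f) u).
Proof.
apply: (mpred_ext (P := fun f => exists e, F f e /\ incident u e)).
  by move=> f; split=> [[e []]|[e]]; exists e.
by apply: mpred_ex_edge => e; apply: mpred_and => //; exact: mpred_const.
Qed.

End MsetGraph.

Lemma mpred_at_most_one_infinite : mpred at_most_one_infinite.
Proof.
do 2!apply: mpred_all => ?.
do 2!(apply: mpred_imply; first by apply: mpred_in_infinite => ?; exact: mpred_coord).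
by apply: mpred_vconn => ?; exact: mpred_coord.
Qed.

Lemma mpred_at_most_two_infinite : mpred at_most_two_infinite.
Proof.
do 3!apply: mpred_all => ?.
do 3!(apply: mpred_imply; first by apply: mpred_in_infinite => ?; exact: mpred_coord).
by do 2?apply: mpred_or; apply: mpred_vconn => ?; exact: mpred_coord.
Qed.

Lemma mpred_encounter c n : mpred (encounter c n).
Proof.
have moff e : mpred (fun psi => outer c n psi e).
  by apply: mpred_andb; [exact: mpred_coord|exact: mpred_const].
have mins e : mpred (fun psi => inner c n psi e).
  by apply: mpred_andb; [exact: mpred_coord|exact: mpred_const].
apply: mpred_and.
  do 2!apply: mpred_all => ?; do 2!(apply: mpred_imply; first exact: mpred_const).
  do 2!(apply: mpred_imply; first exact: mpred_touched).
  exact: mpred_vconn.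
do 3!apply: mpred_ex => ?.
have m3 (P Q R : (L1edge -> bool) -> Prop) : mpred P -> mpred Q -> mpred R ->
    mpred (fun f => [/\ P f, Q f & R f]).
  move=> mP mQ mR; apply: mpred_ext (mpred_and mP (mpred_and mQ mR)) => f.
  by split=> [[? []]|[]].
apply: (m3); [exact: mpred_const|by apply: (m3); exact: mpred_in_infinite|].
by apply: (m3); apply: mpred_not; exact: mpred_vconn.
Qed.

(** * Primal edges as functions of the states *)

Lemma mpred_phi1 e : mpred (fun w => phi1 w e).
Proof.
case: e => [[i j] []]; rewrite /phi1 /= /hval /vval;
  by repeat first [exact: mpred_coord|apply: mpred_eqb|apply: mpred_negb|apply: mpred_andb].
Qed.

Lemma mpred_Omega : mpred Omega.
Proof.
do 2!apply: mpred_all => ?; apply: mpred_imply; first exact: mpred_const.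
rewrite /allowed.
by repeat first [exact: mpred_coord|apply: mpred_negb|apply: mpred_andb|apply: mpred_orb].
Qed.

(** In the allowed patterns the left and right sides of a black face show the same change of state,
    so the edge can be read from either adjacent white face. *)
Lemma Omega_hval w m n : Omega w -> black m n ->
  hval w m n = (w (LL m n) != w (UL m n)) /\ hval w m n = (w (LR m n) != w (UR m n)).
Proof.
move=> Ow /Ow; rewrite /hval /allowed.
by case: (w (LL m n)); case: (w (UL m n)); case: (w (LR m n)); case: (w (UR m n)).
Qed.

Lemma Omega_vval w m n : Omega w -> black m n ->
  vval w m n = (w (LL m n) != w (LR m n)) /\ vval w m n = (w (UL m n) != w (UR m n)).
Proof.
move=> Ow /Ow; rewrite /vval /allowed.
by case: (w (LL m n)); case: (w (UL m n)); case: (w (LR m n)); case: (w (UR m n)).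
Qed.

(* The edges at a vertex of the primal lattice record the changes of state
   around the white face centred there. *)
Lemma Omega_even w : Omega w -> even_degrees (phi1 w).
Proof.
move=> Ow i j; rewrite /phi1 /=.
have b1 : black (2 * i) (2 * j) by rewrite /black; lia.
have b2 : black (2 * (i - 1)) (2 * j) by rewrite /black; lia.
have b3 : black (2 * i - 1) (2 * j + 1) by rewrite /black; lia.
have b4 : black (2 * i - 1) (2 * (j - 1) + 1) by rewrite /black; lia.
(* Each projection picks the side that the black face shares with the white face; the four changes
   then run around a closed cycle. *)
rewrite (Omega_hval Ow b1).1 (Omega_hval Ow b2).2 (Omega_vval Ow b3).1 (Omega_vval Ow b4).2.
rewrite /LL /UL /LR /UR !subrK.
have -> : 2 * (i - 1) + 1 = 2 * i - 1 by lia.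
have -> : 2 * (j - 1) + 1 + 1 = 2 * j by lia.
by case: (w (2 * i, 2 * j)); case: (w (2 * i, 2 * j + 1));
  case: (w (2 * i - 1, 2 * j)); case: (w (2 * i - 1, 2 * j + 1)).
Qed.

(** * Translations *)

Definition tr_vertex (a b : int) (v : L1vert) : L1vert := (v.1 + a, v.2 + b).

Definition shift (a b : int) (psi : L1edge -> bool) : L1edge -> bool :=
  fun e => psi (tr_vertex a b e.1, e.2).

(** One step of the primal lattice is two steps of the square grid, so the period [2 * k] of the
    states becomes [k] for edges. *)
Lemma phi1_translate (a b : int) (w : Config) :
  phi1 (translate (2 * a) (2 * b) w) = shift a b (phi1 w).
Proof.
apply/funext => -[[i j] []]; rewrite /shift /phi1 /= /hval /vval /translate /LL /UL /UR /LR /=.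
  have -> : 2 * (i + a) = 2 * i + 2 * a by lia.
  have -> : 2 * (j + b) = 2 * j + 2 * b by lia.
  by rewrite !(addrAC _ 1).
have -> : 2 * (i + a) - 1 = 2 * i - 1 + 2 * a by lia.
have -> : 2 * (j + b) + 1 = 2 * j + 1 + 2 * b by lia.
by rewrite !(addrAC _ 1).
Qed.

Lemma trK a b v : tr_vertex (- a) (- b) (tr_vertex a b v) = v.
Proof. by case: v => x y; rewrite /tr_vertex /= !addrK. Qed.

Lemma trNK a b v : tr_vertex a b (tr_vertex (- a) (- b) v) = v.
Proof. by case: v => x y; rewrite /tr_vertex /= !subrK. Qed.

Lemma shiftK a b psi : shift (- a) (- b) (shift a b psi) = psi.
Proof. by apply/funext => -[v d]; rewrite /shift /= trNK. Qed.

Lemma endpoints_tr a b e : endpoints (tr_vertex a b e.1, e.2) =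
  (tr_vertex a b (endpoints e).1, tr_vertex a b (endpoints e).2).
Proof. by case: e => [[i j] []]; rewrite /tr_vertex /= addrAC. Qed.

Lemma box_tr a b c n v : box (tr_vertex a b c) n (tr_vertex a b v) = box c n v.
Proof. by rewrite /box /tr_vertex /=; lia. Qed.

Lemma inside_tr a b c n e : inside (tr_vertex a b c) n (tr_vertex a b e.1, e.2) = inside c n e.
Proof. by rewrite /inside endpoints_tr !box_tr. Qed.

Lemma outer_shift a b c n psi :
  outer c n (shift a b psi) = shift a b (outer (tr_vertex a b c) n psi).
Proof. by apply/funext => e; rewrite /outer /shift inside_tr. Qed.

Lemma inner_shift a b c n psi :
  inner c n (shift a b psi) = shift a b (inner (tr_vertex a b c) n psi).
Proof. by apply/funext => e; rewrite /inner /shift inside_tr. Qed.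

Lemma vconn_shift1 a b psi u v :
  vconn (shift a b psi) u v -> vconn psi (tr_vertex a b u) (tr_vertex a b v).
Proof.
elim=> [|x y e _ ux pe xy]; first exact: vconn_refl.
apply: vconn_step ux pe _; rewrite /joins endpoints_tr.
by case: xy => ->; [left|right].
Qed.

Lemma vconn_shift a b psi u v :
  vconn (shift a b psi) u v <-> vconn psi (tr_vertex a b u) (tr_vertex a b v).
Proof.
split; first exact: vconn_shift1.
by rewrite -{1}(shiftK a b psi) => /vconn_shift1; rewrite !trK.
Qed.

Lemma in_infinite_shift1 a b psi u :
  in_infinite (shift a b psi) u -> in_infinite psi (tr_vertex a b u).
Proof.
move=> iu m; have [v uv mv] := iu (m + (absz a + absz b))%N.
exists (tr_vertex a b v); first exact: vconn_shift1.
by move: mv; rewrite /box /tr_vertex /=; lia.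
Qed.

Lemma in_infinite_shift a b psi u :
  in_infinite (shift a b psi) u <-> in_infinite psi (tr_vertex a b u).
Proof.
split; first exact: in_infinite_shift1.
by rewrite -{1}(shiftK a b psi) => /in_infinite_shift1; rewrite trK.
Qed.

Lemma touched_shift1 a b psi u : touched (shift a b psi) u -> touched psi (tr_vertex a b u).
Proof.
case=> e pe ue; exists (tr_vertex a b e.1, e.2) => //; rewrite /incident endpoints_tr.
by case: ue => ->; [left|right].
Qed.

Lemma touched_shift a b psi u : touched (shift a b psi) u <-> touched psi (tr_vertex a b u).
Proof.
split; first exact: touched_shift1.
by rewrite -{1}(shiftK a b psi) => /touched_shift1; rewrite trK.
Qed.

Lemma at_most_one_infinite_shift1 a b psi :
  at_most_one_infinite psi -> at_most_one_infinite (shift a b psi).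
Proof. by move=> h u v /in_infinite_shift iu /in_infinite_shift iv; apply/vconn_shift/h. Qed.

Lemma at_most_one_infinite_shift a b psi :
  at_most_one_infinite (shift a b psi) <-> at_most_one_infinite psi.
Proof.
split; last exact: at_most_one_infinite_shift1.
by move/(@at_most_one_infinite_shift1 (- a) (- b) _); rewrite shiftK.
Qed.

Lemma at_most_two_infinite_shift1 a b psi :
  at_most_two_infinite psi -> at_most_two_infinite (shift a b psi).
Proof.
move=> h u v w /in_infinite_shift iu /in_infinite_shift iv /in_infinite_shift iw.
by have [?|[?|?]] := h _ _ _ iu iv iw; [left|right; left|right; right]; apply/vconn_shift.
Qed.

Lemma at_most_two_infinite_shift a b psi :
  at_most_two_infinite (shift a b psi) <-> at_most_two_infinite psi.
Proof.
split; last exact: at_most_two_infinite_shift1.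
by move/(@at_most_two_infinite_shift1 (- a) (- b) _); rewrite shiftK.
Qed.

Lemma encounter_shift1 a b c n psi :
  encounter c n (shift a b psi) -> encounter (tr_vertex a b c) n psi.
Proof.
rewrite /encounter outer_shift inner_shift => -[conn [u1 [u2 [u3 [bs us ns]]]]]; split.
  move=> u v; rewrite -(trNK a b u) -(trNK a b v) !box_tr => bu bv.
  move=> /(iffRL (@touched_shift a b _ _)) tu /(iffRL (@touched_shift a b _ _)) tv.
  exact/vconn_shift1/conn.
exists (tr_vertex a b u1), (tr_vertex a b u2), (tr_vertex a b u3); rewrite !box_tr; split=> //.
  by case: us => ? ? ?; split; exact: in_infinite_shift1.
by case: ns => n12 n13 n23; split=> /(iffRL (@vconn_shift a b _ _ _)).
Qed.

Lemma encounter_shift a b c n psi :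
  encounter c n (shift a b psi) <-> encounter (tr_vertex a b c) n psi.
Proof.
split; first exact: encounter_shift1.
by rewrite -{1}(shiftK a b psi) => /encounter_shift1; rewrite trK.
Qed.

(** * Null events and the density of encounter boxes *)

Section Measure.
Variables (R : realType) (k : nat) (mu : probability Config R).

Definition null (P : EdgeConfig -> Prop) : Prop := mu.-negligible [set w | P (phi1 w)].

Lemma mpred_comp_phi1 (P : EdgeConfig -> Prop) : mpred P ->
  measurable ([set w | P (phi1 w)] : set Config).
Proof. by move=> mP; apply: mpred_preimage => //; exact: mpred_phi1. Qed.

Lemma null_eq0 P : mpred P -> null P <-> mu [set w | P (phi1 w)] = 0%E.
Proof. by move=> mP; apply: negligibleP; exact: mpred_comp_phi1. Qed.

Lemma null_ex (T : countType) (P : T -> EdgeConfig -> Prop) :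
  (forall t, null (P t)) -> null (fun psi => exists t, P t psi).
Proof.
move=> nP; rewrite /null.
have := @negligible_bigcup _ _ _ mu
  (fun n => if unpickle n is Some t then [set w | P t (phi1 w)] else set0).
move=> /(_ _)/(negligibleS _); apply.
  move=> w [t Pt]; exists (pickle t) => //; by rewrite pickleK.
move=> n; case: (unpickle n) => [t|]; [exact: nP|exact: negligible_set0].
Qed.

Hypothesis A4 : forall (S : L1vert) (E : set EdgeConfig), measurable E ->
  (0 < mu (phi1 @^-1` E))%E -> (0 < mu (phi1 @^-1` (flip S @` E)))%E.

Lemma mpred_flip S (P : EdgeConfig -> Prop) : mpred P -> mpred (fun psi => P (flip S psi)).
Proof.
move=> mP; apply: mpred_preimage => // e; rewrite /flip.
by case: (side_of S e); [apply: mpred_negb|]; exact: mpred_coord.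
Qed.

(** (A4) read backwards: if the flipped event had positive probability, so would its image under the
    flip, which is [P] since a flip is an involution. *)
Lemma null_flip S (P : EdgeConfig -> Prop) : mpred P -> null P -> null (fun psi => P (flip S psi)).
Proof.
move=> mP /(null_eq0 mP) P0; apply/(null_eq0 (mpred_flip S mP)).
apply/eqP; rewrite eq_le measure_ge0 andbT leNgt; apply/negP => pos.
have := @A4 S _ (mpred_flip S mP) pos; rewrite lt_neqAle => /andP[/eqP + _]; apply.
rewrite -P0; apply/esym; congr (mu _); apply/seteqP; split=> w /=.
  by case=> psi Ppsi <-.
move=> Pw; exists (flip S (phi1 w)); last first.
  by apply/funext => e; rewrite /flip; case: (side_of S e); rewrite ?negbK.
rewrite /=; suff -> : flip S (flip S (phi1 w)) = phi1 w by [].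
by apply/funext => e; rewrite /flip; case: (side_of S e); rewrite ?negbK.
Qed.

Lemma null_flips s (P : EdgeConfig -> Prop) :
  mpred P -> null P -> null (fun psi => P (flips s psi)).
Proof.
elim: s P => [//|S s IH] P mP nP /=.
exact: (IH (fun psi => P (flip S psi)) (mpred_flip S mP) (null_flip S mP nP)).
Qed.

Hypothesis k_gt0 : (0 < k)%N.
Hypothesis Ak1 : forall (a b : int) (A : set Config), measurable A ->
  mu (translate (2 * k%:Z * a) (2 * k%:Z * b) @^-1` A) = mu A.

Lemma mu_encounter_tr (a b : int) n :
  mu [set w | encounter (k%:Z * a, k%:Z * b) n (phi1 w)] =
  mu [set w | encounter (0, 0) n (phi1 w)].
Proof.
rewrite -(Ak1 a b (mpred_comp_phi1 (mpred_encounter (0, 0) n))); congr (mu _).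
apply/seteqP; split=> w /=; rewrite -!mulrA phi1_translate.
  by move=> h; apply/encounter_shift; rewrite /tr_vertex !add0r.
by move=> /encounter_shift; rewrite /tr_vertex !add0r.
Qed.

(** The expected number of encounter boxes among [M * M] translates is bounded pointwise by the
    length of a sphere around them. The spacing [K] is a multiple of the period [k] and at least
    [n + n + 1], which keeps the boxes disjoint. *)
Lemma encounter_density n M K : (0 < M)%N -> K = (k * (n + n).+1)%N ->
  fine (mu [set w | encounter (0, 0) n (phi1 w)]) *+ (M * M) <=
  (4 * (((K * M + n).+1) + (K * M + n).+1).+1)%:R.
Proof.
move=> M0 defK.
set E := fun c => [set w : Config | encounter c n (phi1 w)].
have mE c : measurable (E c) by apply: mpred_comp_phi1; exact: mpred_encounter.
pose s : seq L1vert := [seq ((K * a)%N%:Z, (K * b)%N%:Z) | a <- iota 0 M, b <- iota 0 M].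
have K0 : (0 < K)%N by rewrite defK muln_gt0 k_gt0.
have ss : size s = (M * M)%N by rewrite size_allpairs !size_iota.
have us : uniq s.
  apply: allpairs_uniq; try exact: iota_uniq.
  move=> [a b] [a' b'] _ _ /= [/eqP + /eqP].
  by rewrite !eqn_pmul2l // => /eqP-> /eqP->.
have sP c : c \in s -> exists a b, [/\ (a < M)%N, (b < M)%N & c = ((K * a)%N%:Z, (K * b)%N%:Z)].
  move=> /allpairsP[[a b] /= []]; rewrite !mem_iota /= !add0n => aM bM ->.
  by exists a, b.
have muE c : c \in s -> mu (E c) = mu (E (0, 0)).
  move=> /sP[a [b [_ _ ->]]].
  rewrite -(mu_encounter_tr ((n + n).+1 * a)%N ((n + n).+1 * b)%N n).
  by rewrite -!PoszM defK !mulnA.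
have muE0 : mu (E (0, 0)) = (fine (mu (E (0, 0))))%:E.
  by rewrite fineK // fin_num_measure.
rewrite -/(E (0, 0)) -lee_fin.
have -> : (fine (mu (E (0, 0))) *+ (M * M))%:E =
    (\int[mu]_(w in setT) (\sum_(c <- s) (\1_(E c) w)%:E))%E.
  rewrite ge0_integral_sum //; last first.
    by move=> c; apply/measurable_realfun.measurable_EFinP;
      exact: measurable_realfun.measurable_indic.
  rewrite (eq_big_seq (fun=> (fine (mu (E (0, 0))))%:E)); last first.
    by move=> c cs; rewrite integral_indic // setIT; exact: etrans (muE c cs) muE0.
  rewrite (sumEFin s xpredT (fun=> fine (mu (E (0, 0))))).
  by rewrite big_const_seq count_predT iter_addr addr0 ss.
set N := (4 * _)%N.
apply: (@le_trans _ _ (\int[mu]_(w in setT) (cst (N%:R : R)%:E w))%E).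
  apply: ge0_le_integral => //.
  - by move=> w _; apply: sume_ge0 => c _; rewrite lee_fin.
  - apply: emeasurable_sum => c; apply/measurable_realfun.measurable_EFinP;
    exact: measurable_realfun.measurable_indic.
  move=> w _ /=; rewrite sumEFin lee_fin.
  have -> : \sum_(c <- s) \1_(E c) w = (size [seq c <- s | `[< E c w >]])%:R :> R.
    rewrite size_filter -sum1_count natr_sum [RHS]big_mkcond /=.
    apply: eq_bigr => c _; rewrite indicE; case: asboolP => [h|h].
      by rewrite mem_set.
    by rewrite memNset.
  (* All translates lie in the box of radius [K * M + n], one less than that of the sphere. *)
  rewrite ler_nat; apply: (@encounters_bound (phi1 w) n) => //.
  - exact: filter_uniq.
  - move=> c v; rewrite mem_filter => /andP[_ /sP[a [b [aM bM ->]]]].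
    have := leq_mul (leqnn K) (ltnW aM); have := leq_mul (leqnn K) (ltnW bM).
    by rewrite /box /=; lia.
  - move=> c d v; rewrite !mem_filter => /andP[_ /sP[a [b [_ _ ->]]]].
    move=> /andP[_ /sP[a' [b' [_ _ ->]]]].
    rewrite /box xpair_eqE negb_and /= => neq h; apply/negP => h'.
    have far x y : (x < y)%N -> ((K * x)%N%:Z + (n + n)%:Z < (K * y)%N%:Z :> int).
      move=> xy; have := leq_mul (leqnn K) xy; rewrite mulnS.
      have : ((n + n).+1 <= K)%N by rewrite defK leq_pmull.
      by lia.
    have [ab|ab|ab] := ltngtP a a'; [have := far _ _ ab; lia|have := far _ _ ab; lia|].
    have [cd|cd|cd] := ltngtP b b'; [have := far _ _ cd; lia|have := far _ _ cd; lia|].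
    by move: neq; rewrite ab cd !eqxx.
  - by move=> c; rewrite mem_filter => /andP[/asboolP].
by rewrite integral_cst //= probability_setT mule1.
Qed.

Lemma null_encounter n : null (encounter (0, 0) n).
Proof.
apply/(null_eq0 (mpred_encounter (0, 0) n)).
set E := [set w | _].
have muE : mu E = (fine (mu E))%:E by rewrite fineK // fin_num_measure //;
  exact: mpred_comp_phi1 (mpred_encounter _ _).
have p0 : 0 <= fine (mu E) by rewrite fine_ge0.
rewrite muE; congr (_%:E); apply/eqP; rewrite eq_le p0 andbT leNgt; apply/negP => pos.
(* [C] is the bound for [M = 1]. The bound for [M] is at most [C * M], which the quadratic left-hand
   side exceeds for large [M]. *)
pose K := (k * (n + n).+1)%N; pose C := (4 * ((K + n).+1 + (K + n).+1).+1)%N.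
have [M M0 hM] : exists2 M, (0 < M)%N & (C%:R : R) < fine (mu E) * M%:R.
  exists (Num.bound (C%:R / fine (mu E))).+1 => //.
  rewrite mulrC -ltr_pdivrMr //; apply: lt_trans (archi_boundP _) _.
    by rewrite divr_ge0.
  by rewrite ltr_nat.
have := encounter_density M0 (erefl K); rewrite -/E -[_ *+ (M * M)]mulr_natr (natrM _ M M) mulrA.
apply/negP; rewrite -ltNge; apply: (@le_lt_trans _ _ (C%:R * M%:R)); last first.
  by rewrite ltr_pM2r // ltr0n.
rewrite -natrM ler_nat /C; have : (n.+1 <= n.+1 * M)%N by rewrite leq_pmulr.
by nia.
Qed.

End Measure.

(** * Zero-one law and conclusion *)

Unset Implicit Arguments.

Theorem theorem1p4 (R : realType) (k : nat) (k_gt0 : (0 < k)%N)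
  (mu : probability Config R)
  (* mu is a probability measure on Omega *)
  (muOmega : mu Omega = 1%E)
  (* (Ak1) *)
  (Ak1 : forall (a b : int) (A : set Config), measurable A ->
     mu (translate (2 * k%:Z * a) (2 * k%:Z * b) @^-1` A) = mu A)
  (* (Ak2) *)
  (Ak2 : forall A : set Config, measurable A ->
     (forall a b : int, translate (2 * k%:Z * a) (2 * k%:Z * b) @^-1` A = A) ->
     mu A = 0%E \/ mu A = 1%E)
  (* (A4), with nu1 E = mu (phi1 @^-1` E) the law of phi(w) restricted to E(L1) *)
  (A4 : forall (S : L1vert) (E : set EdgeConfig), measurable E ->
     (0 < mu (phi1 @^-1` E))%E ->
     (0 < mu (phi1 @^-1` (flip S @` E)))%E) :
  {ae mu, forall w : Config, at_most_one_infinite_primal (phi1 w)}.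
Proof.
have full (A : set Config) : measurable A -> mu A = 1%E -> mu.-negligible (~` A).
  move=> mA A1; apply/negligibleP; first exact: measurableC.
  by apply: etrans (probability_setC mu mA) _; rewrite A1 subee.
have zero_one (P : (L1edge -> bool) -> Prop) : mpred P ->
    (forall a b psi, P (shift a b psi) <-> P psi) ->
    null mu P \/ null mu (fun psi => ~ P psi).
  move=> mP inv; have mA := mpred_comp_phi1 mP.
  have [|A0|A1] := Ak2 _ mA.
  - move=> a b; apply/seteqP; split=> w /=; rewrite -!mulrA phi1_translate.
      by move/(iffLR (inv _ _ _)).
    by move/(iffRL (inv (k%:Z * a) (k%:Z * b) _)).
  - by left; apply/(null_eq0 mu mP).
  - by right; exact: full A1.
(* Two null events cannot cover [Omega], which has full measure and on which all degrees are
   even. *)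
have nonnull (P : EdgeConfig -> Prop) (Q : EdgeConfig -> Prop) : null mu P -> null mu Q ->
    (forall psi, even_degrees psi -> ~ P psi -> Q psi) -> False.
  move=> nP nQ cover.
  suff : mu.-negligible (setT : set Config).
    move/(negligibleP mu measurableT)/(etrans (esym (probability_setT mu)))/eqP.
    by rewrite onee_eq0.
  apply: (negligibleS _ (negligibleU (full _ mpred_Omega muOmega) (negligibleU nP nQ))).
  move=> w _; have [Ow|] := pselect (Omega w); last by left.
  right; have [Pw|nPw] := pselect (P (phi1 w)); first by left.
  by right; apply: cover => //; exact: Omega_even.
have [n1|n1] := zero_one _ mpred_at_most_one_infinite at_most_one_infinite_shift; last first.
  by apply: negligibleS n1 => w /= + h; apply; exact: one_infinite_cluster_contour.
exfalso.
have nflips (P : EdgeConfig -> Prop) : mpred P -> null mu P ->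
    null mu (fun psi => exists s, P (flips s psi)).
  by move=> mP nP; apply: null_ex => s; exact: (null_flips A4).
(* If at most two infinite clusters is a null event, almost every configuration becomes an encounter
   after finitely many flips, which is again a null event. *)
have [n2|n2] := zero_one _ mpred_at_most_two_infinite at_most_two_infinite_shift.
  apply: (nonnull _ _ n2 (null_ex (fun n =>
    nflips _ (mpred_encounter _ _) (null_encounter k_gt0 Ak1 n)))).
  by move=> psi ev h; have [n [s]] := many_in_infinite_encounter ev h; exists n, s.
(* There remain exactly two infinite clusters almost surely; finitely many flips then lead into the
   null event of at most one. *)
have n12 : null mu (fun psi => ~ at_most_two_infinite psi \/ at_most_one_infinite psi).
  exact: negligibleU n2 n1.
apply: (nonnull _ _ n12 (nflips _ mpred_at_most_one_infinite n1)) =>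
  psi ev /not_orP[/contrapT two one].
exact: two_in_infinite_merge.
Qed.
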